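(* Let $S$ be a finite virtual flat biquandle, $A$ an abelian group without 2-torsion, and $\phi:S\times S\to A$ a map that is a 2-cocycle both of the complex $\mathrm{Hom}(C^{VF}_\ast(S),A)$ and of the complex $\mathrm{Hom}(C^{SF}_\ast(S),A)$; explicitly, for all $a,b,c\in S$: (1) $\phi(a,b)+\phi(b\circ a,a\ast b)=0$; (2) $-\phi(b,c)+\phi(b\circ a,c\circ a)+\phi(a\ast b,c)-\phi(a,c\circ b)-\phi(a\ast c,b\ast c)+\phi(a,b)=0$; (3) $-\phi(b,c)+\phi(b,c\circ a)+\phi(a,c)-\phi(a,c\circ b)=0$. Then for an oriented flat virtual link diagram $L$ the state-sum $\Phi_\phi(L)\in\mathbb{Z}[A]$ is invariant under flat Reidemeister moves, hence is an invariant of the flat virtual link represented by $L$.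
   Context: A virtual flat biquandle is a set $S$ with two binary operations $a\ast b$, $a\circ b$; writing $S_b(a)=a\ast b$, $T_b(a)=a\circ b$, for all $a,b$: $S_aS_b=S_bS_a$, $T_aT_b=T_bT_a$, $S_aT_b=T_bS_a$; $S_a=S_{T_b(a)}=S_{S_b(a)}$, $T_a=T_{S_b(a)}=T_{T_b(a)}$; $T_aS_a=S_aT_a=\mathrm{id}$. Complexes: $C_n(S)$ is free abelian on $n$-tuples of elements of $S$. $C^{VF}_\ast(S)=C_\ast(S)/C'_\ast(S)$ with boundary $\partial_n(a_1,\dots,a_n)=\sum_{i=1}^n(-1)^i((a_1\ast a_i,\dots,a_{i-1}\ast a_i,a_{i+1},\dots,a_n)-(a_1,\dots,a_{i-1},a_{i+1}\circ a_i,\dots,a_n\circ a_i))$ ($n\ge2$), where $C'_n(S)$ is generated by $(a_1,\dots,a_i,a_{i+1},\dots,a_n)+(a_1,\dots,a_{i+1}\circ a_i,a_i\ast a_{i+1},\dots,a_n)$. $C^{SF}_\ast(S)=C_\ast(S)$ with boundary $d_n(a_1,\dots,a_n)=\sum_{i=1}^{n-1}(-1)^i((a_1,\dots,\widehat{a_i},\dots,a_n)-(a_1,\dots,\widehat{a_i},\dots,a_{n-1},a_n\circ a_i))$. Conditions (1),(2),(3) are exactly the cocycle conditions in these two complexes. Flat virtual link diagrams have flat crossings (no over/under information) and virtual crossings; flat Reidemeister moves are the generalized Reidemeister moves (classical, virtual $\Omega_1',\Omega_2',\Omega_3'$, and mixed $\Omega_3^s$) with real crossings replaced by flat crossings. A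 v-arc is a part of the diagram between consecutive virtual crossings. A coloring $\theta$ assigns an element of $S$ to each v-arc such that at each virtual crossing $\tau$, rotated so both strands point downward, if the incoming upper-left v-arc has color $a$ and the incoming upper-right v-arc has color $b$, then the outgoing arc continuing the upper-left strand has color $a\ast b$ and the outgoing arc continuing the upper-right strand has color $b\circ a$; the weight of $\tau$ is then $B(\tau,\theta)=\phi(a,b)\in A$. The state-sum is $\Phi_\phi(L)=\sum_\theta \big[\sum_\tau B(\tau,\theta)\big]\in\mathbb{Z}[A]$, where $[x]$ denotes the basis element of the group ring $\mathbb{Z}[A]$ corresponding to $x\in A$ (i.e. the product over virtual crossings of the weights, written multiplicatively in $\mathbb{Z}[A]$), the sum being over all colorings. *)

(* Defs.v *)
From Stdlib Require Import Relations.
From mathcomp Require Import all_boot all_algebra.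
Set Implicit Arguments. Unset Strict Implicit. Unset Printing Implicit Defensive.
Import GRing.Theory.
Local Open Scope ring_scope.

Definition vf_biquandle (S : Type) (star circ : S -> S -> S) : Prop :=
  (forall a b x, star (star x b) a = star (star x a) b) /\
  (forall a b x, circ (circ x b) a = circ (circ x a) b) /\
  (forall a b x, star (circ x b) a = circ (star x a) b) /\
  (forall a b x, star x a = star x (circ a b)) /\
  (forall a b x, star x a = star x (star a b)) /\
  (forall a b x, circ x a = circ x (star a b)) /\
  (forall a b x, circ x a = circ x (circ a b)) /\
  (forall a x, circ (star x a) a = x) /\
  (forall a x, star (circ x a) a = x).

Definition cocycle_conditions (S : Type) (A : zmodType) (star circ : S -> S -> S)
    (phi : S -> S -> A) : Prop :=
  (forall a b, phi a b + phi (circ b a) (star a b) = 0) /\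
  (forall a b c, - phi b c + phi (circ b a) (circ c a) + phi (star a b) c
                 - phi a (circ c b) - phi (star a c) (star b c) + phi a b = 0) /\
  (forall a b c, - phi b c + phi b (circ c a) + phi a c - phi a (circ c b) = 0).

(* A diagram has a finite set of 4-valent crossings (flat or virtual) and a  *)
(* finite set of 2-valent "beads" (auxiliary marked points on strands, which *)
(* play no role; a crossingless circle is a bead whose two ends are joined). *)
(* At a crossing c the four half-edges (c,0),(c,1),(c,2),(c,3) are numbered  *)
(* COUNTERCLOCKWISE in the plane; the two strands through c are {0,2} and    *)
(* {1,3}.  At a bead the half-edges (b,false),(b,true) form one strand.      *)
(* fv_lnk pairs half-edges into edges; fv_inc h says that the orientation    *)
(* of the strand points INTO the vertex of h along h.                        *)
Record fv_diagram := FVDiagram {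
  fvC : finType;
  fvB : finType;
  fv_virt : fvC -> bool;
  fv_lnk : (fvC * 'I_4 + fvB * bool)%type -> (fvC * 'I_4 + fvB * bool)%type;
  fv_inc : (fvC * 'I_4 + fvB * bool)%type -> bool }.
Arguments fv_virt : clear implicits.
Arguments fv_lnk : clear implicits.
Arguments fv_inc : clear implicits.

Definition hedge (L : fv_diagram) : finType := (fvC L * 'I_4 + fvB L * bool)%type.

Definition sh (k : nat) (i : 'I_4) : 'I_4 := inZp (i + k)%N.

Definition fv_wf (L : fv_diagram) : Prop :=
  (forall h : hedge L, fv_lnk L (fv_lnk L h) = h) /\
  (forall h : hedge L, fv_lnk L h <> h) /\
  (forall h : hedge L, fv_inc L (fv_lnk L h) = ~~ fv_inc L h) /\
  (forall (c : fvC L) (i : 'I_4),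
      fv_inc L (inl (c, sh 2 i)) = ~~ fv_inc L (inl (c, i))) /\
  (forall b : fvB L, fv_inc L (inr (b, true)) = ~~ fv_inc L (inr (b, false))).

(* Planarity: the rotation system is planar, i.e. every connected component *)
(* has genus 0:  V - E + F = 2 * (#components), with V = #C + #B,            *)
(* E = 2 #C + #B.                                                            *)
Definition rot_inv (L : fv_diagram) (h : hedge L) : hedge L :=
  match h with
  | inl (c, i) => inl (c, sh 3 i)
  | inr (b, s) => inr (b, ~~ s)
  end.
Definition face_perm (L : fv_diagram) (h : hedge L) : hedge L := rot_inv (fv_lnk L h).
Definition fv_faces (L : fv_diagram) : {set {set hedge L}} :=
  [set [set h' | fconnect (@face_perm L) h h'] | h : hedge L].
Definition hvx (L : fv_diagram) (h : hedge L) : (fvC L + fvB L)%type :=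
  match h with inl (c, _) => inl c | inr (b, _) => inr b end.
Definition fv_adj (L : fv_diagram) : rel (hedge L) :=
  fun h h' => (h' == fv_lnk L h) || (hvx h' == hvx h).
Definition fv_comps (L : fv_diagram) : {set {set hedge L}} :=
  [set [set h' | connect (@fv_adj L) h h'] | h : hedge L].
Definition fv_planar (L : fv_diagram) : Prop :=
  (#|fv_faces L| = #|fvC L| + 2 * #|fv_comps L|)%N.

(* A coloring of v-arcs is encoded as a map on half-edges which is constant  *)
(* along edges, through beads and through flat crossings (so constant on     *)
(* v-arcs), and obeys the rule at virtual crossings.  Port i of crossing c   *)
(* is the incoming upper-left one (after rotating so that both strands point *)
(* downward) iff it is incoming and the next port counterclockwise is        *)
(* outgoing; then i+3 is the incoming upper-right port, i+2 continues the    *)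
(* upper-left strand and i+1 continues the upper-right strand.               *)
Definition ul_port (L : fv_diagram) (c : fvC L) (i : 'I_4) : bool :=
  fv_inc L (inl (c, i)) && ~~ fv_inc L (inl (c, sh 1 i)).

Definition is_coloring (L : fv_diagram) (S : finType) (star circ : S -> S -> S)
    (th : {ffun hedge L -> S}) : bool :=
  [forall h : hedge L, th (fv_lnk L h) == th h] &&
  [forall b : fvB L, th (inr (b, true)) == th (inr (b, false))] &&
  [forall c : fvC L, forall i : 'I_4,
     if fv_virt L c then
       ul_port c i ==>
         ((th (inl (c, sh 2 i)) == star (th (inl (c, i))) (th (inl (c, sh 3 i)))) &&
          (th (inl (c, sh 1 i)) == circ (th (inl (c, sh 3 i))) (th (inl (c, i)))))
     else th (inl (c, sh 2 i)) == th (inl (c, i))].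

Definition coloring_weight (L : fv_diagram) (S : finType) (A : zmodType)
    (phi : S -> S -> A) (th : {ffun hedge L -> S}) : A :=
  \sum_(c : fvC L | fv_virt L c) \sum_(i : 'I_4 | ul_port c i)
      phi (th (inl (c, i))) (th (inl (c, sh 3 i))).

(* An element of the group ring Z[A], given by its coefficient function. *)
Definition group_ring (A : Type) := A -> int.

(* Phi_phi(L) = sum_theta [weight(theta)]: the coefficient of [x] is the    *)
(* number of colorings of weight x.                                         *)
Definition state_sum (S : finType) (A : zmodType) (star circ : S -> S -> S)
    (phi : S -> S -> A) (L : fv_diagram) : group_ring A :=
  fun x => (#|[set th : {ffun hedge L -> S} |
               is_coloring star circ th && (coloring_weight phi th == x)]|)%:Z.

Definition hmap (L L' : fv_diagram) (f : fvC L -> fvC L') (g : fvB L -> fvB L')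
    (h : hedge L) : hedge L' :=
  match h with
  | inl (c, i) => inl (f c, i)
  | inr (b, s) => inr (g b, s)
  end.

Definition kept (L : fv_diagram) (D : {set fvC L}) (DB : {set fvB L}) (h : hedge L) : bool :=
  match h with inl (c, _) => c \notin D | inr (b, _) => b \notin DB end.

(* L and L' agree outside the removed vertices D, DB of L and the added     *)
(* vertices D', DB' of L' (via the bijections f, g of the kept vertices),   *)
(* except for the edges at the boundary half-edges bnd.                     *)
Definition frame (L L' : fv_diagram) (bnd : {set hedge L})
    (D : {set fvC L}) (DB : {set fvB L}) (D' : {set fvC L'}) (DB' : {set fvB L'})
    (f : fvC L -> fvC L') (g : fvB L -> fvB L') : Prop :=
  {in ~: D &, injective f} /\ f @: (~: D) = ~: D' /\
  {in ~: DB &, injective g} /\ g @: (~: DB) = ~: DB' /\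
  (forall c, c \notin D -> fv_virt L' (f c) = fv_virt L c) /\
  (forall h : hedge L, kept D DB h -> h \notin bnd -> kept D DB (fv_lnk L h) ->
      fv_lnk L' (hmap f g h) = hmap f g (fv_lnk L h)) /\
  (forall h : hedge L, kept D DB h -> fv_inc L' (hmap f g h) = fv_inc L h).

(* insertion of a bead b on an edge (this, with its inverse, also accounts  *)
(* for relabelling, i.e. planar isotopy)                                    *)
Definition bead_move (L L' : fv_diagram) : Prop :=
  exists f g (b : fvB L') (h1 h2 : hedge L),
    frame [set h1; h2] set0 set0 set0 [set b] f g /\
    fv_lnk L h1 = h2 /\
    fv_lnk L' (hmap f g h1) = inr (b, false) /\
    fv_lnk L' (inr (b, true)) = hmap f g h2.

(* Omega1 (flat crossing) / Omega1' (virtual crossing): creation of a kink *)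
Definition omega1 (L L' : fv_diagram) : Prop :=
  exists f g (c : fvC L') (i : 'I_4) (h1 h2 : hedge L),
    frame [set h1; h2] set0 set0 [set c] set0 f g /\
    fv_lnk L h1 = h2 /\
    fv_lnk L' (inl (c, i)) = inl (c, sh 1 i) /\
    fv_lnk L' (hmap f g h1) = inl (c, sh 2 i) /\
    fv_lnk L' (hmap f g h2) = inl (c, sh 3 i).

(* Omega2 (two flat) / Omega2' (two virtual crossings): creation of a bigon *)
(* between two distinct edges h1--h1' and h2--h2'.                         *)
Definition omega2 (L L' : fv_diagram) : Prop :=
  exists f g (c1 c2 : fvC L') (i j : 'I_4) (h1 h1' h2 h2' : hedge L),
    c1 != c2 /\
    frame [set h1; h1'; h2; h2'] set0 set0 [set c1; c2] set0 f g /\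
    fv_lnk L h1 = h1' /\ fv_lnk L h2 = h2' /\ h2 != h1 /\ h2 != h1' /\
    fv_virt L' c1 = fv_virt L' c2 /\
    fv_lnk L' (inl (c1, i)) = inl (c2, j) /\
    fv_lnk L' (inl (c1, sh 1 i)) = inl (c2, sh 3 j) /\
    fv_lnk L' (hmap f g h1) = inl (c1, sh 2 i) /\
    fv_lnk L' (hmap f g h1') = inl (c2, sh 2 j) /\
    fv_lnk L' (hmap f g h2) = inl (c1, sh 3 i) /\
    fv_lnk L' (hmap f g h2') = inl (c2, sh 1 j).

Definition triangle (L : fv_diagram) (c1 c2 c3 : fvC L) (a b d : 'I_4)
    (q1 q2 q3 q4 q5 q6 : hedge L) : Prop :=
  fv_lnk L (inl (c1, sh 1 a)) = inl (c2, b) /\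
  fv_lnk L (inl (c2, sh 1 b)) = inl (c3, d) /\
  fv_lnk L (inl (c3, sh 1 d)) = inl (c1, a) /\
  fv_lnk L (inl (c1, sh 2 a)) = q1 /\ fv_lnk L (inl (c1, sh 3 a)) = q2 /\
  fv_lnk L (inl (c2, sh 2 b)) = q3 /\ fv_lnk L (inl (c2, sh 3 b)) = q4 /\
  fv_lnk L (inl (c3, sh 2 d)) = q5 /\ fv_lnk L (inl (c3, sh 3 d)) = q6.

(* Omega3 (three flat), Omega3' (three virtual), mixed Omega3^s (two virtual *)
(* crossings and one flat): the triangle is replaced by its rotation by 180 *)
(* degrees, each crossing keeping its type (the forbidden case of exactly   *)
(* one virtual crossing is excluded).                                       *)
Definition omega3 (L L' : fv_diagram) : Prop :=
  exists f g (c1 c2 c3 : fvC L) (a b d : 'I_4) (c1' c2' c3' : fvC L') (a' b' d' : 'I_4)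
         (p1 p2 p3 p4 p5 p6 : hedge L),
    uniq [:: c1; c2; c3] /\ uniq [:: c1'; c2'; c3'] /\
    frame [set p1; p2; p3; p4; p5; p6] [set c1; c2; c3] set0 [set c1'; c2'; c3'] set0 f g /\
    all (kept [set c1; c2; c3] set0) [:: p1; p2; p3; p4; p5; p6] /\
    triangle c1 c2 c3 a b d p1 p2 p3 p4 p5 p6 /\
    triangle c1' c2' c3' a' b' d'
      (hmap f g p6) (hmap f g p3) (hmap f g p2) (hmap f g p5) (hmap f g p4) (hmap f g p1) /\
    fv_virt L' c1' = fv_virt L c1 /\ fv_virt L' c2' = fv_virt L c2 /\
    fv_virt L' c3' = fv_virt L c3 /\
    count (fv_virt L) [:: c1; c2; c3] != 1%N.

Definition flat_move (L L' : fv_diagram) : Prop :=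
  bead_move L L' \/ omega1 L L' \/ omega2 L L' \/ omega3 L L'.

Definition fv_equiv : fv_diagram -> fv_diagram -> Prop :=
  clos_refl_sym_trans fv_diagram
    (fun L L' => fv_wf L /\ fv_planar L /\ fv_wf L' /\ fv_planar L' /\ flat_move L L').

(* Main.v *)
(* A crossing acts on the colour of one strand by an operator that depends on
   the other strand only through its operator class, and these operators all
   commute and preserve the classes.  Hence the colours on one side of a local
   picture determine those inside it and on the other side, which makes the
   colourings before and after a move correspond.

   A virtual crossing of strands with inner colours x, y and orientation flags
   s, t has weight [om s t x y].  By condition (1) this is antisymmetric,
   om s t x y = - om t s y x, which kills kinks (with 2-torsion excluded) and
   bigons; moreover reversing one strand only changes the sign after twisting
   the colour of the other one.  So all orientations of the third move reduce
   to a single one, for which the identity is condition (2), or condition (3)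
   when one crossing is flat. *)
From Stdlib Require Import FunctionalExtensionality.
Require Import Defs.
From mathcomp Require Import all_boot all_algebra.
Set Implicit Arguments. Unset Strict Implicit. Unset Printing Implicit Defensive.
Import GRing.Theory.
Local Open Scope ring_scope.

(** A relation that is total and injective suffices for the comparison, so no explicit map between
    colourings is needed. Applied in both directions it shows that the numbers of colourings of a
    given weight are equal. *)
Lemma leq_card_rel (T T' : finType) (P : pred T) (P' : pred T') (R : T -> T' -> Prop) :
  (forall t, P t -> exists2 t', P' t' & R t t') ->
  (forall t1 t2 t', P t1 -> P t2 -> R t1 t' -> R t2 t' -> t1 = t2) ->
  (#|[set t | P t]| <= #|[set t | P' t]|)%N.
Proof.
move=> ex inj.
(* Option values give a default outside [P], where [T'] may have no element to offer. *)
have [F HF] : exists F : T -> option T', forall t, P t ->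
    exists t', [/\ F t = Some t', P' t' & R t t'].
  apply: (fin_all_exists (P := fun t o => P t ->
            exists t', [/\ o = Some t', P' t' & R t t'])) => t.
  have [/ex[t' p r]|] := boolP (P t); first by exists (Some t') => _; exists t'.
  by exists None.
have injF : {in [set t | P t] &, injective F}.
  move=> t1 t2; rewrite !inE => p1 p2.
  have [t1' [-> _ r1]] := HF _ p1; have [t2' [-> _ r2]] := HF _ p2.
  by case=> E; rewrite E in r1; apply: inj r1 r2.
rewrite -(card_in_imset injF) -(card_imset [set t | P' t] (f := Some)); last by move=> ? ? [].
apply/subset_leq_card/subsetP => o /imsetP[t]; rewrite inE => p ->.
by have [t' [-> p' _]] := HF _ p; rewrite imset_f ?inE.
Qed.

(** * Operators of a virtual flat biquandle *)

Section Biquandle.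
Variables (S : finType) (star circ : S -> S -> S) (A : zmodType) (phi : S -> S -> A).
Hypothesis biq : vf_biquandle star circ.

(** [v] marks a virtual crossing. As [circ] by [y] inverts [star] by [y], negating [s] inverts the
    operator, and a flat crossing is the identity operator. One calculus thus serves all crossing
    types and orientations. *)
Definition act (v s : bool) (x y : S) : S :=
  if v then (if s then star x y else circ x y) else x.

Lemma star_star x y z : star x (star y z) = star x y.
Proof. by case: biq => _ [_ [_ [_ [H _]]]]; rewrite -H. Qed.
Lemma star_circ x y z : star x (circ y z) = star x y.
Proof. by case: biq => _ [_ [_ [H _]]]; rewrite -H. Qed.
Lemma circ_star x y z : circ x (star y z) = circ x y.
Proof. by case: biq => _ [_ [_ [_ [_ [H _]]]]]; rewrite -H. Qed.
Lemma circ_circ x y z : circ x (circ y z) = circ x y.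
Proof. by case: biq => _ [_ [_ [_ [_ [_ [H _]]]]]]; rewrite -H. Qed.
Lemma starK x y : circ (star x y) y = x.
Proof. by case: biq => _ [_ [_ [_ [_ [_ [_ [H _]]]]]]]. Qed.
Lemma circK x y : star (circ x y) y = x.
Proof. by case: biq => _ [_ [_ [_ [_ [_ [_ [_ H]]]]]]]. Qed.

Definition biqE := (star_star, star_circ, circ_star, circ_circ, starK, circK).

Lemma act_act v s w t x y z : act v s x (act w t y z) = act v s x y.
Proof. by case: v s w t => [] [] [] [] //=; rewrite biqE. Qed.

Lemma actK v s x y : act v (~~ s) (act v s x y) y = x.
Proof. by case: v s => [] [] //=; rewrite biqE. Qed.

Lemma actNK v s x y : act v s (act v (~~ s) x y) y = x.
Proof. by case: v s => [] [] //=; rewrite biqE. Qed.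

Lemma actC v s w t x y z :
  act v s (act w t x y) z = act w t (act v s x z) y.
Proof.
case: biq => SS [TT [ST _]].
by case: v s w t => [] [] [] [] //=; rewrite -?ST // ?(SS z y) ?(TT z y).
Qed.

(** By [act_act], [x] and [y] both have the operator class of the common value, so the same
    invertible operator is applied to both. This closes up the strand of a kink. *)
Lemma act_swap v s x y : act v s x y = act v s y x -> x = y.
Proof.
move=> E; rewrite -(actK v s x y) -[RHS](actK v s y x) -E.
by rewrite -(act_act _ _ v s _ y x) -E act_act.
Qed.

(** * Weight of a single crossing and its symmetries *)

Hypothesis coc : cocycle_conditions star circ phi.

(* Consider a virtual crossing whose ports, numbered counterclockwise
   from a base port, are coloured x0, x1, x2, x3; s and t tell whether ports 0
   and 3 are incoming.  The colouring rule then says x2 = act true t x0 x1 and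
   x3 = act true s x1 x0, and the weight is om s t x0 x1.  The sign makes the
   formula uniform in the orientations, by condition (1). *)
Definition om (s t : bool) (x y : S) : A :=
  let w := phi (if s then y else circ y x) (if t then star x y else x) in
  if s == t then - w else w.

Lemma phi_swap x y : phi (circ y x) (star x y) = - phi x y.
Proof. by case: coc => H _; apply/eqP; rewrite -addr_eq0 addrC H. Qed.

Lemma om_swap s t x y : om s t x y = - om t s y x.
Proof.
rewrite /om (eq_sym t s); case: s t => [] [] /=; rewrite ?opprK.
- by rewrite -phi_swap !biqE.
- by rewrite phi_swap opprK.
- by rewrite phi_swap.
by rewrite -phi_swap !biqE.
Qed.

(** The twisted colour is the one at port 3, across the strand of [x]: reversing that strand
    exchanges the sides on which the other colour is read. *)
Lemma om_negl s t x y : om (~~ s) t x y = - om s t x (act true (~~ s) y x).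
Proof. by rewrite /om /act; case: s t => [] [] /=; rewrite ?biqE ?opprK. Qed.

Lemma om_negr s t x y : om s (~~ t) x y = - om s t (act true (~~ t) x y) y.
Proof. by rewrite om_swap om_negl [om t s _ _]om_swap !opprK. Qed.

(** This is the reading from the opposite base port: a half-turn negates both flags and replaces
    ports 0 and 1 by ports 2 and 3, whose colours are the two twisted ones. *)
Lemma om_neg2 s t x y :
  om (~~ s) (~~ t) x y =
  om s t (act true (~~ t) x y) (act true (~~ s) y x).
Proof. by rewrite om_negl om_negr opprK /act; case: s t => [] []; rewrite ?biqE. Qed.

Hypothesis tors : forall a : A, a + a = 0 -> a = 0.

(** Antisymmetry makes the value its own negative, and without 2-torsion it must vanish. *)
Lemma om_diag s x : om s s x x = 0.
Proof. by apply: tors; rewrite {2}om_swap addrN. Qed.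

(** * Balance of weights when a triangle is turned over *)

Definition omv (v s t : bool) (x y : S) : A := if v then om s t x y else 0.

Lemma omv_neg2 v s t x y :
  omv v (~~ s) (~~ t) x y =
  omv v s t (act v (~~ t) x y) (act v (~~ s) y x).
Proof. by case: v; rewrite /omv ?om_neg2. Qed.

(* The change of the weight at the crossing of the strands x and y of a
   triangle when the strand z is moved across it; v1, v2, v3 tell whether the
   crossings xy, yz, zx are virtual. *)
Definition drift v1 v2 v3 e1 e2 e3 x y z : A :=
  omv v1 e1 e2 x y - omv v1 e1 e2 (act v3 e3 x z) (act v2 e3 y z).

Definition drift_sum v1 v2 v3 e1 e2 e3 x y z : A :=
  drift v1 v2 v3 e1 e2 e3 x y z + drift v2 v3 v1 e2 e3 e1 y z x
  + drift v3 v1 v2 e3 e1 e2 z x y.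

Lemma drift_sum_cycle v1 v2 v3 e1 e2 e3 x y z :
  drift_sum v1 v2 v3 e1 e2 e3 x y z = drift_sum v2 v3 v1 e2 e3 e1 y z x.
Proof. by rewrite /drift_sum -addrA addrC. Qed.

Lemma omv_negl v s t x y : omv v (~~ s) t x y = - omv v s t x (act v (~~ s) y x).
Proof. by case: v; rewrite /omv ?oppr0 // om_negl. Qed.

Lemma omv_negr v s t x y : omv v s (~~ t) x y = - omv v s t (act v (~~ t) x y) y.
Proof. by case: v; rewrite /omv ?oppr0 // om_negr. Qed.

(* Reversing the strand x. *)
Lemma drift_sum_neg v1 v2 v3 e1 e2 e3 x y z :
  drift_sum v1 v2 v3 (~~ e1) e2 e3 x y z =
  - drift_sum v1 v2 v3 e1 e2 e3 x (act v1 (~~ e1) y x) (act v3 (~~ e1) z x).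
Proof.
rewrite /drift_sum /drift !omv_negl !omv_negr !act_act !actNK !opprD !opprK.
rewrite (actC v1 _ v2) (actC v3 _ v2).
congr (_ + _ + _); exact: addrC.
Qed.

(** [drift_sum_neg] carries the identity, for all colours at once, to the orientation with the first
    strand reversed; cyclic symmetry brings each strand to the front. *)
Lemma drift_sum_base v1 v2 v3 f1 f2 f3 :
  (forall x y z, drift_sum v1 v2 v3 f1 f2 f3 x y z = 0) ->
  forall e1 e2 e3 x y z, drift_sum v1 v2 v3 e1 e2 e3 x y z = 0.
Proof.
have reverse w1 w2 w3 g1 g2 g3 :
    (forall x y z, drift_sum w1 w2 w3 g1 g2 g3 x y z = 0) ->
    forall e x y z, drift_sum w1 w2 w3 e g2 g3 x y z = 0.
  move=> H e x y z; case: (eqVneq e g1) => [-> //|ne].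
  have -> : e = ~~ g1 by case: e g1 ne {H} => [] [].
  by rewrite drift_sum_neg H oppr0.
(* Two cyclic shifts put the third strand first; the three rounds adjust the strands in the order 3,
   2, 1. *)
move=> H e1 e2 e3 x y z; rewrite 2!drift_sum_cycle.
apply: (reverse _ _ _ f3) => {}x {}y {}z; rewrite 2!drift_sum_cycle.
apply: (reverse _ _ _ f2) => {}x {}y {}z; rewrite 2!drift_sum_cycle.
exact: (reverse _ _ _ f1).
Qed.

Lemma drift_sum_VVV e1 e2 e3 x y z :
  drift_sum true true true e1 e2 e3 x y z = 0.
Proof.
apply: (drift_sum_base (f1 := true) (f2 := false) (f3 := false)) => {}x {}y {}z.
(* The first entry is [circ z y] because [star] by [y] turns it back into [z]. The six terms of
   condition (2) are then the six weights, up to a global sign. *)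
have [_ [H _]] := coc; have := H (circ z y) y x.
have [_ [_ [ST _]]] := biq.
rewrite /drift_sum /drift /omv !(om_swap false true) /om /act /= !biqE -!ST => E.
rewrite -[RHS]oppr0 -{}E !opprD !opprK.
by rewrite [LHS](AC (2*2*2) (1*2*5*6*4*3)).
Qed.

Lemma drift_sum_FVV e1 e2 e3 x y z :
  drift_sum false true true e1 e2 e3 x y z = 0.
Proof.
apply: (drift_sum_base (f1 := false) (f2 := false) (f3 := true)) => {}x {}y {}z.
(* The flat crossing contributes nothing, and the other four weights are the terms of condition
   (3). *)
have [_ [_ H]] := coc; have := H x y z.
rewrite /drift_sum /drift /omv !(om_swap false true) /om /act /= => E.
by rewrite subr0 add0r opprK !addrA.
Qed.

(** A single flat crossing can be shifted cyclically to the first place; three flat crossings carry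
    no weight. The excluded count is the forbidden move. *)
Lemma drift_sum0 v1 v2 v3 e1 e2 e3 x y z : count id [:: v1; v2; v3] != 1%N ->
  drift_sum v1 v2 v3 e1 e2 e3 x y z = 0.
Proof.
case: v1 v2 v3 => [] [] [] //= _.
- exact: drift_sum_VVV.
- by rewrite -drift_sum_cycle; apply: drift_sum_FVV.
- by rewrite drift_sum_cycle; apply: drift_sum_FVV.
- exact: drift_sum_FVV.
by rewrite /drift_sum /drift /omv !subrr !addr0.
Qed.

(** * Ports of a crossing as rotations of a base port *)

Lemma mem_sh (a j : 'I_4) : j \in [:: a; sh 1 a; sh 2 a; sh 3 a].
Proof. by case: a j => [[|[|[|[|]]]] ?] // [[|[|[|[|]]]] ?]. Qed.

Lemma uniq_sh (a : 'I_4) : uniq [:: a; sh 1 a; sh 2 a; sh 3 a].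
Proof. by case: a => [[|[|[|[|]]]] ?]. Qed.

Lemma shE (a : 'I_4) :
  (sh 1 (sh 1 a) = sh 2 a) * (sh 2 (sh 1 a) = sh 3 a) * (sh 3 (sh 1 a) = a)
  * (sh 1 (sh 2 a) = sh 3 a) * (sh 2 (sh 2 a) = a) * (sh 3 (sh 2 a) = sh 1 a)
  * (sh 1 (sh 3 a) = a) * (sh 2 (sh 3 a) = sh 1 a) * (sh 3 (sh 3 a) = sh 2 a).
Proof. by do !split; apply: val_inj; case: a => [[|[|[|[|]]]] ?]. Qed.

Lemma forall_sh (P : 'I_4 -> Prop) a :
  P a -> P (sh 1 a) -> P (sh 2 a) -> P (sh 3 a) -> forall j, P j.
Proof.
move=> P0 P1 P2 P3 j; have := mem_sh a j.
by rewrite !inE => /or4P [] /eqP ->.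
Qed.

Lemma forallb_sh (P : 'I_4 -> bool) a :
  [forall i, P i] = [&& P a, P (sh 1 a), P (sh 2 a) & P (sh 3 a)].
Proof.
apply/forallP/and4P => [H|[]]; [by split | exact: forall_sh].
Qed.

Lemma sum_sh (F : 'I_4 -> A) a :
  \sum_i F i = F a + (F (sh 1 a) + (F (sh 2 a) + F (sh 3 a))).
Proof.
have /(perm_big _) -> : perm_eq (index_enum 'I_4) [:: a; sh 1 a; sh 2 a; sh 3 a].
  apply: uniq_perm; [exact: index_enum_uniq | exact: uniq_sh |].
  by move=> j; rewrite mem_index_enum mem_sh.
by rewrite !big_cons big_nil /= addr0.
Qed.

Definition quad (T : Type) (a : 'I_4) (x0 x1 x2 x3 : T) (j : 'I_4) : T :=
  if j == a then x0 else if j == sh 1 a then x1 else if j == sh 2 a then x2 else x3.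

Lemma quadE (T : Type) a (x0 x1 x2 x3 : T) :
  (quad a x0 x1 x2 x3 a = x0) * (quad a x0 x1 x2 x3 (sh 1 a) = x1)
  * (quad a x0 x1 x2 x3 (sh 2 a) = x2) * (quad a x0 x1 x2 x3 (sh 3 a) = x3).
Proof. by case: a => [[|[|[|[|]]]] ?]. Qed.

(** * Colouring rule and weight, one crossing at a time *)

Definition crossing_rule (L : fv_diagram) (th : {ffun hedge L -> S}) (c : fvC L) : bool :=
  [forall i : 'I_4,
     if fv_virt L c then
       ul_port c i ==>
         ((th (inl (c, sh 2 i)) == star (th (inl (c, i))) (th (inl (c, sh 3 i)))) &&
          (th (inl (c, sh 1 i)) == circ (th (inl (c, sh 3 i))) (th (inl (c, i)))))
     else th (inl (c, sh 2 i)) == th (inl (c, i))].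

(** The value 0 at flat crossings lets the total weight be a sum over all crossings. *)
Definition crossing_weight (L : fv_diagram) (th : {ffun hedge L -> S}) (c : fvC L) : A :=
  if fv_virt L c then
    \sum_(i : 'I_4 | ul_port c i) phi (th (inl (c, i))) (th (inl (c, sh 3 i)))
  else 0.

Lemma is_coloringP (L : fv_diagram) (th : {ffun hedge L -> S}) :
  is_coloring star circ th <->
  [/\ forall h, th (fv_lnk L h) = th h,
      forall b, th (inr (b, true)) = th (inr (b, false)) &
      forall c, crossing_rule th c].
Proof.
split=> [/andP[/andP[/forallP H1 /forallP H2] /forallP H3] | [H1 H2 H3]].
  by split=> [h|b|c]; [apply/eqP | apply/eqP | exact: H3].
by apply/andP; split; [apply/andP; split|]; apply/forallP => w;
   [apply/eqP | apply/eqP | exact: H3].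
Qed.

Section WellFormed.
Variables (L : fv_diagram).
Hypothesis wf : fv_wf L.
Implicit Types (th : {ffun hedge L -> S}) (c : fvC L) (a : 'I_4).

Lemma lnkK h : fv_lnk L (fv_lnk L h) = h.
Proof. by case: wf. Qed.

Lemma inc_lnk h : fv_inc L (fv_lnk L h) = ~~ fv_inc L h.
Proof. by case: wf => _ [_ []]. Qed.

Lemma inc_sh2 c a : fv_inc L (inl (c, sh 2 a)) = ~~ fv_inc L (inl (c, a)).
Proof. by case: wf => _ [_ [_ []]]. Qed.

Lemma inc_sh3 c a : fv_inc L (inl (c, sh 3 a)) = ~~ fv_inc L (inl (c, sh 1 a)).
Proof. by rewrite -inc_sh2 shE. Qed.

(** A normal form of the rule for any base port and any orientation. Exactly one port is upper left,
    and invertibility of the operators moves the rule from there to [a]. *)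
Lemma crossing_ruleP th c a :
  crossing_rule th c <->
  th (inl (c, sh 2 a)) =
    act (fv_virt L c) (fv_inc L (inl (c, sh 3 a))) (th (inl (c, a))) (th (inl (c, sh 1 a)))
  /\ th (inl (c, sh 3 a)) =
    act (fv_virt L c) (fv_inc L (inl (c, a))) (th (inl (c, sh 1 a))) (th (inl (c, a))).
Proof.
rewrite /crossing_rule (forallb_sh _ a).
rewrite /ul_port !shE /= !inc_sh3 !inc_sh2.
case: (fv_virt L c) => /=; last first.
  split=> [/and4P[/eqP-> /eqP->] //|[-> ->]]; by rewrite !eqxx.
case: (fv_inc L (inl (c, a))) (fv_inc L (inl (c, sh 1 a))) => [] [] /=; rewrite ?andbT.
all: by split=> [/andP[/eqP-> /eqP->]|[-> ->]]; rewrite ?biqE ?eqxx.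
Qed.

(** The same normal form from the opposite base port, so that the colours at two adjacent outer
    ports determine the inner ones. *)
Lemma crossing_rule_inv th c a : crossing_rule th c ->
  th (inl (c, a)) =
    act (fv_virt L c) (fv_inc L (inl (c, sh 1 a))) (th (inl (c, sh 2 a))) (th (inl (c, sh 3 a)))
  /\ th (inl (c, sh 1 a)) =
    act (fv_virt L c) (~~ fv_inc L (inl (c, a))) (th (inl (c, sh 3 a))) (th (inl (c, sh 2 a))).
Proof. by move/(crossing_ruleP _ _ (sh 2 a)); rewrite !shE inc_sh2. Qed.

Lemma crossing_rule_ext th1 th2 c a j : crossing_rule th1 c -> crossing_rule th2 c ->
  th1 (inl (c, sh 2 a)) = th2 (inl (c, sh 2 a)) ->
  th1 (inl (c, sh 3 a)) = th2 (inl (c, sh 3 a)) ->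
  th1 (inl (c, j)) = th2 (inl (c, j)).
Proof.
move=> /(@crossing_rule_inv _ _ a)[Y0 Y1] /(@crossing_rule_inv _ _ a)[Z0 Z1] X2 X3.
by apply: (forall_sh (a := a) (P := fun j => th1 (inl (c, j)) = th2 (inl (c, j))));
  rewrite ?Y0 ?Y1 ?Z0 ?Z1 ?X2 ?X3.
Qed.

(** The sum has one term, at the upper-left port. When the two flags agree, condition (1) turns that
    term into the form chosen in [om]; otherwise it has that form already. *)
Lemma crossing_weightE th c a : crossing_rule th c ->
  crossing_weight th c =
  omv (fv_virt L c) (fv_inc L (inl (c, a))) (fv_inc L (inl (c, sh 3 a)))
    (th (inl (c, a))) (th (inl (c, sh 1 a))).
Proof.
move/(crossing_ruleP _ _ a); rewrite /crossing_weight /omv; case: fv_virt => // -[].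
rewrite big_mkcond (sum_sh _ a) /ul_port !shE /= !inc_sh3 !inc_sh2 /act /om.
case: (fv_inc L (inl (c, a))) (fv_inc L (inl (c, sh 1 a))) => [] [] /= E F;
  rewrite ?add0r ?addr0 ?E ?F //.
- by rewrite -phi_swap !biqE.
by rewrite -phi_swap !biqE.
Qed.
End WellFormed.

(** * Transport of colourings between diagrams that differ locally *)

Section Frame.
Variables (L L' : fv_diagram) (bnd : {set hedge L}).
Variables (D : {set fvC L}) (DB : {set fvB L}) (D' : {set fvC L'}) (DB' : {set fvB L'}).
Variables (f : fvC L -> fvC L') (g : fvB L -> fvB L').
Hypothesis wf' : fv_wf L'.
Hypothesis fr : frame bnd D DB D' DB' f g.
Hypothesis bnd_outer : forall h, kept D DB h -> ~~ kept D DB (fv_lnk L h) -> h \in bnd.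
Hypothesis bnd_new : forall h, h \in bnd -> kept D DB h ->
  ~~ kept D' DB' (fv_lnk L' (hmap f g h)).
Implicit Types (th : {ffun hedge L -> S}) (u : {ffun hedge L' -> S}).

Lemma hmap_kept h : kept D DB h -> kept D' DB' (hmap f g h).
Proof.
case: fr => _ [imf [_ [img _]]].
by case: h => [[c i]|[b s]] /= k; rewrite -in_setC -?imf -?img imset_f ?inE.
Qed.

Lemma hmap_inj h1 h2 :
  kept D DB h1 -> kept D DB h2 -> hmap f g h1 = hmap f g h2 -> h1 = h2.
Proof.
case: fr => injf [_ [injg _]].
case: h1 h2 => [[c i]|[b s]] [[c' i']|[b' s']] //= k k' [].
  by move=> /injf; rewrite !inE => /(_ k k') -> ->.
by move=> /injg; rewrite !inE => /(_ k k') -> ->.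
Qed.

Lemma hmap_surj h' : kept D' DB' h' -> exists2 h, kept D DB h & hmap f g h = h'.
Proof.
case: fr => _ [imf [_ [img _]]].
case: h' => [[c i]|[b s]] /=; rewrite -in_setC -?imf -?img => /imsetP[x].
  by rewrite inE => k ->; exists (inl (x, i)).
by rewrite inE => k ->; exists (inr (x, s)).
Qed.

Definition agree th u := forall h, kept D DB h -> u (hmap f g h) = th h.

(** Edges are tested from their ends at [E] and [EB], which includes the edges joining these
    vertices to the rest of the diagram. *)
Definition local_coloring (K : fv_diagram) (E : {set fvC K}) (EB : {set fvB K})
    (t : {ffun hedge K -> S}) :=
  [/\ forall h, ~~ kept E EB h -> t (fv_lnk K h) = t h,
      forall b, b \in EB -> t (inr (b, true)) = t (inr (b, false)) &
      forall c, c \in E -> crossing_rule t c].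

Lemma lnk_inner h : kept D DB h -> h \notin bnd ->
  kept D DB (fv_lnk L h) /\ fv_lnk L' (hmap f g h) = hmap f g (fv_lnk L h).
Proof.
move=> k nb; have k2 : kept D DB (fv_lnk L h).
  by apply/negPn/negP => /(bnd_outer k); apply/negP.
by case: fr => _ [_ [_ [_ [_ [H _]]]]]; split=> //; apply: H.
Qed.

Lemma crossing_rule_agree th u c :
  agree th u -> c \notin D -> crossing_rule u (f c) = crossing_rule th c.
Proof.
move=> ag nD; case: fr => _ [_ [_ [_ [vf [_ incf]]]]].
apply: eq_forallb => i; rewrite vf // /ul_port.
by rewrite -!(ag (inl (c, _))) // -!(incf (inl (c, _))).
Qed.

Lemma crossing_weight_agree th u c :
  agree th u -> c \notin D -> crossing_weight u (f c) = crossing_weight th c.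
Proof.
move=> ag nD; case: fr => _ [_ [_ [_ [vf [_ incf]]]]].
rewrite /crossing_weight vf //; case: fv_virt => //.
apply: eq_big => [i|i _]; first by rewrite /ul_port -!(incf (inl (c, _))).
by rewrite -!(ag (inl (c, _))).
Qed.

(** An edge of [L'] either copies a kept edge of [L] or has an end at a new vertex, where the local
    conditions apply; a copied boundary half-edge is of the second kind. *)
Lemma agree_coloring th u : agree th u ->
  is_coloring star circ th -> local_coloring D' DB' u -> is_coloring star circ u.
Proof.
case: (fr) => _ [imf [_ [img _]]].
move=> ag /is_coloringP[H1 H2 H3] [K1 K2 K3]; apply/is_coloringP; split.
- move=> h'; have [k'|/K1 //] := boolP (kept D' DB' h').
  have [h k E] := hmap_surj k'; rewrite -{}E in k' *.
  have [hb|hb] := boolP (h \in bnd).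
    by rewrite -(K1 _ (bnd_new hb k)) lnkK.
  by have [k2 ->] := lnk_inner k hb; rewrite !ag ?H1.
- move=> b; have [/K2 //|] := boolP (b \in DB').
  rewrite -in_setC -img => /imsetP[x]; rewrite inE => k ->.
  by rewrite !(ag (inr (x, _))) ?H2.
move=> c; have [/K3 //|] := boolP (c \in D').
rewrite -in_setC -imf => /imsetP[x]; rewrite inE => k ->.
by rewrite (crossing_rule_agree ag k).
Qed.

(** Boundary edges need their own premise: a move that creates vertices cuts edges of [L] whose ends
    are both kept, so neither [u] nor the local conditions at once give their equations. *)
Lemma agree_coloring_inv th u : agree th u ->
  is_coloring star circ u -> local_coloring D DB th ->
  (forall h, h \in bnd -> th (fv_lnk L h) = th h) -> is_coloring star circ th.
Proof.
move=> ag /is_coloringP[H1 H2 H3] [K1 K2 K3] Kb; apply/is_coloringP; split.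
- move=> h; have [k|/K1 //] := boolP (kept D DB h).
  have [/Kb //|hb] := boolP (h \in bnd).
  by have [k2 E] := lnk_inner k hb; rewrite -!ag // -E H1.
- move=> b; have [/K2 //|nb] := boolP (b \in DB).
  by rewrite -!(ag (inr (b, _))) //= H2.
move=> c; have [/K3 //|nc] := boolP (c \in D).
by rewrite -(crossing_rule_agree ag nc).
Qed.

Lemma agree_weight th u : agree th u ->
  \sum_(c in D') crossing_weight u c = \sum_(c in D) crossing_weight th c ->
  coloring_weight phi u = coloring_weight phi th.
Proof.
move=> ag E; case: (fr) => injf [imf _].
have weightE K (t : {ffun hedge K -> S}) :
    coloring_weight phi t = \sum_c crossing_weight t c.
  by rewrite /coloring_weight big_mkcond.
rewrite !{}weightE (bigID (mem D')) [RHS](bigID (mem D)) /= E; congr (_ + _).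
transitivity (\sum_(c in f @: ~: D) crossing_weight u c).
  by apply: eq_bigl => c; rewrite imf inE.
rewrite big_imset //=; apply: eq_big => [c|c]; rewrite inE // => nD.
exact: crossing_weight_agree.
Qed.

(** The premises make [agree] a bijection of colourings: the first two extend the colours over the
    replaced part, the last two make the extension unique. The middle one matches the weights. *)
Lemma state_sum_frame :
  (forall th, is_coloring star circ th -> exists v : hedge L' -> S,
     forall u, agree th u -> (forall h, ~~ kept D' DB' h -> u h = v h) ->
     local_coloring D' DB' u) ->
  (forall u, is_coloring star circ u -> exists v : hedge L -> S,
     forall th, agree th u -> (forall h, ~~ kept D DB h -> th h = v h) ->
     local_coloring D DB th /\ forall h, h \in bnd -> th (fv_lnk L h) = th h) ->
  (forall th u, agree th u -> is_coloring star circ th -> is_coloring star circ u ->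
     \sum_(c in D') crossing_weight u c = \sum_(c in D) crossing_weight th c) ->
  (forall u1 u2, is_coloring star circ u1 -> is_coloring star circ u2 ->
     (forall h, kept D' DB' h -> u1 h = u2 h) -> u1 =1 u2) ->
  (forall th1 th2, is_coloring star circ th1 -> is_coloring star circ th2 ->
     (forall h, kept D DB h -> th1 h = th2 h) -> th1 =1 th2) ->
  state_sum star circ phi L = state_sum star circ phi L'.
Proof.
move=> fwd bwd wt uniq' uniq_; apply: functional_extensionality => x.
rewrite /state_sum; congr (_%:Z); apply/eqP; rewrite eqn_leq; apply/andP; split.
  apply: (leq_card_rel (R := agree)) => [th /andP[col /eqP <-]|th1 th2 u].
    have [v Hv] := fwd _ col.
    (* A kept preimage under [hmap] is searched for; it is unique by [hmap_inj], and half-edges at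
       new vertices fall through to [v]. *)
    pose u : {ffun hedge L' -> S} := [ffun h' =>
      if [pick h | kept D DB h && (hmap f g h == h')] is Some h then th h else v h'].
    have ag : agree th u.
      move=> h k; rewrite ffunE; case: pickP => [h1 /andP[k1 /eqP E]|/(_ h)].
        by rewrite (hmap_inj k1 k E).
      by rewrite k eqxx.
    have colu : is_coloring star circ u.
      apply: (agree_coloring ag col); apply: Hv => // h' nk; rewrite ffunE.
      by case: pickP => // h /andP[/hmap_kept k /eqP E]; rewrite E (negPf nk) in k.
    by exists u => //; rewrite colu (agree_weight ag) ?eqxx // (wt th u).
  move=> /andP[c1 _] /andP[c2 _] a1 a2; apply/ffunP; apply: uniq_ => // h k.
  by rewrite -a1 // a2.
apply: (leq_card_rel (R := fun u th => agree th u)) => [u /andP[col /eqP <-]|u1 u2 th].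
  have [v Hv] := bwd _ col.
  pose th : {ffun hedge L -> S} := [ffun h => if kept D DB h then u (hmap f g h) else v h].
  have ag : agree th u by move=> h k; rewrite ffunE k.
  have [|loc bd] := Hv _ ag; first by move=> h /negPf nk; rewrite ffunE nk.
  have colth : is_coloring star circ th := agree_coloring_inv ag col loc bd.
  by exists th => //; rewrite colth -(agree_weight ag) ?eqxx // (wt th u).
move=> /andP[c1 _] /andP[c2 _] a1 a2; apply/ffunP; apply: uniq' => // h'.
by move=> /hmap_surj[h k <-]; rewrite a1 // a2.
Qed.
End Frame.

(** * Colourings of the triangle in the third move *)

Definition tri_rel v1 v2 v3 e1 e2 e3 x y z q1 q2 q3 q4 q5 q6 : Prop :=
  [/\ q1 = act v1 e2 x y, q2 = act v1 e1 y x, q3 = act v2 e3 y z, q4 = act v2 e2 z y &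
      q5 = act v3 e1 z x /\ q6 = act v3 e3 x z].

(** The middle segment of each strand of the turned triangle carries both operators of the other two
    strands. As these commute and depend only on classes, crossing one strand back cancels its
    operator and leaves the old colour of the opposite end. *)
Lemma tri_rel_flip v1 v2 v3 e1 e2 e3 x y z q1 q2 q3 q4 q5 q6 :
  tri_rel v1 v2 v3 e1 e2 e3 x y z q1 q2 q3 q4 q5 q6 ->
  tri_rel v1 v2 v3 (~~ e1) (~~ e2) (~~ e3) (act v3 e3 (act v1 e2 x y) z)
    (act v1 e1 (act v2 e3 y z) x) (act v2 e2 (act v3 e1 z x) y) q6 q3 q2 q5 q4 q1.
Proof.
case=> -> -> -> -> [-> ->]; rewrite /tri_rel !act_act !actK.
by do !split=> //; rewrite actC actK.
Qed.

Section Triangle.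
Variables (L : fv_diagram) (c1 c2 c3 : fvC L) (a b d : 'I_4) (q1 q2 q3 q4 q5 q6 : hedge L).
Hypothesis wf : fv_wf L.
Hypothesis tri : triangle c1 c2 c3 a b d q1 q2 q3 q4 q5 q6.
Implicit Types (th : {ffun hedge L -> S}).

Lemma triangle_lnk :
  [/\ fv_lnk L (inl (c2, b)) = inl (c1, sh 1 a), fv_lnk L (inl (c3, d)) = inl (c2, sh 1 b)
    & fv_lnk L (inl (c1, a)) = inl (c3, sh 1 d)].
Proof. by case: tri => [<- [<- [<- _]]]; rewrite !lnkK. Qed.

(** Flags are opposite at the ends of an edge and at opposite ports, so those at [a], [b], [d] fix
    all the others. *)
Lemma triangle_inc_sh3 :
  [/\ fv_inc L (inl (c1, sh 3 a)) = fv_inc L (inl (c2, b)),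
      fv_inc L (inl (c2, sh 3 b)) = fv_inc L (inl (c3, d)) &
      fv_inc L (inl (c3, sh 3 d)) = fv_inc L (inl (c1, a))].
Proof. by case: tri => [<- [<- [<- _]]]; rewrite !inc_lnk // !inc_sh3. Qed.

Lemma triangle_inc :
  [/\ fv_inc L q1 = fv_inc L (inl (c1, a)), fv_inc L q2 = ~~ fv_inc L (inl (c2, b)),
      fv_inc L q3 = fv_inc L (inl (c2, b)) &
      [/\ fv_inc L q4 = ~~ fv_inc L (inl (c3, d)), fv_inc L q5 = fv_inc L (inl (c3, d)) &
          fv_inc L q6 = ~~ fv_inc L (inl (c1, a))]].
Proof.
have [E1 E2 E3] := triangle_inc_sh3.
case: tri => [_ [_ [_ [<- [<- [<- [<- [<- <-]]]]]]]].
by rewrite !inc_lnk // E1 E2 E3 !inc_sh2 // !negbK.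
Qed.

Lemma triangle_unkept (h : hedge L) : ~~ kept [set c1; c2; c3] set0 h ->
  exists j, [\/ h = inl (c1, j), h = inl (c2, j) | h = inl (c3, j)].
Proof.
case: h => [[c j]|[e s]] /=; rewrite !inE // negbK => /orP[/orP[]|] /eqP->; exists j.
- exact: Or31.
- exact: Or32.
exact: Or33.
Qed.

Lemma triangle_outer h : ~~ kept [set c1; c2; c3] set0 h ->
  kept [set c1; c2; c3] set0 (fv_lnk L h) -> fv_lnk L h \in [set q1; q2; q3; q4; q5; q6].
Proof.
have [F1 F2 F3] := triangle_lnk; case: (tri) => [T1 [T2 [T3 [T4 [T5 [T6 [T7 [T8 T9]]]]]]]].
pose P c j := kept [set c1; c2; c3] set0 (fv_lnk L (inl (c, j))) ->
  fv_lnk L (inl (c, j)) \in [set q1; q2; q3; q4; q5; q6].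
move=> /triangle_unkept[j []->].
- apply: (forall_sh (a := a) (P := P c1)); rewrite /P ?T1 ?F3 ?T4 ?T5 /= !inE ?eqxx ?orbT //.
- apply: (forall_sh (a := b) (P := P c2)); rewrite /P ?T2 ?F1 ?T6 ?T7 /= !inE ?eqxx ?orbT //.
apply: (forall_sh (a := d) (P := P c3)); rewrite /P ?T3 ?F2 ?T8 ?T9 /= !inE ?eqxx ?orbT //.
Qed.

Lemma triangle_boundary h : h \in [set q1; q2; q3; q4; q5; q6] ->
  ~~ kept [set c1; c2; c3] set0 (fv_lnk L h).
Proof.
case: tri => [_ [_ [_ [<- [<- [<- [<- [<- <-]]]]]]]].
by rewrite !inE => /orP[/orP[/orP[/orP[/orP[]|]|]|]|] /eqP->; rewrite lnkK //= !inE eqxx ?orbT.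
Qed.

Lemma triangle_coloring th : is_coloring star circ th ->
  tri_rel (fv_virt L c1) (fv_virt L c2) (fv_virt L c3)
    (fv_inc L (inl (c1, a))) (fv_inc L (inl (c2, b))) (fv_inc L (inl (c3, d)))
    (th (inl (c1, a))) (th (inl (c1, sh 1 a))) (th (inl (c2, sh 1 b)))
    (th q1) (th q2) (th q3) (th q4) (th q5) (th q6).
Proof.
move=> /is_coloringP[H1 _ H3].
have [I1 I2 I3] := triangle_inc_sh3; have [F1 F2 F3] := triangle_lnk.
have [X2 X3] := proj1 (crossing_ruleP wf th c1 a) (H3 c1).
have [Y2 Y3] := proj1 (crossing_ruleP wf th c2 b) (H3 c2).
have [Z2 Z3] := proj1 (crossing_ruleP wf th c3 d) (H3 c3).
have Ey : th (inl (c2, b)) = th (inl (c1, sh 1 a)) by rewrite -F1 H1.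
have Ez : th (inl (c3, d)) = th (inl (c2, sh 1 b)) by rewrite -F2 H1.
have Ex : th (inl (c3, sh 1 d)) = th (inl (c1, a)) by rewrite -F3 H1.
case: tri => [_ [_ [_ [<- [<- [<- [<- [<- <-]]]]]]]]; rewrite !H1.
by rewrite X2 X3 Y2 Y3 Z2 Z3 I1 I2 I3 Ex Ey Ez.
Qed.

(** Each corner has two adjacent outer ports, and their colours determine the other two. *)
Lemma triangle_ext th1 th2 : is_coloring star circ th1 -> is_coloring star circ th2 ->
  th1 q1 = th2 q1 -> th1 q2 = th2 q2 -> th1 q3 = th2 q3 -> th1 q4 = th2 q4 ->
  th1 q5 = th2 q5 -> th1 q6 = th2 q6 ->
  forall h, ~~ kept [set c1; c2; c3] set0 h -> th1 h = th2 h.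
Proof.
move=> /is_coloringP[C1 _ D1] /is_coloringP[C2 _ D2].
case: tri => [_ [_ [_ [<- [<- [<- [<- [<- <-]]]]]]]]; rewrite !C1 !C2.
move=> E1 E2 E3 E4 E5 E6 h /triangle_unkept[j []->].
- exact: (crossing_rule_ext wf _ (D1 c1) (D2 c1) E1 E2).
- exact: (crossing_rule_ext wf _ (D1 c2) (D2 c2) E3 E4).
exact: (crossing_rule_ext wf _ (D1 c3) (D2 c3) E5 E6).
Qed.

(** The value at beads is a placeholder: only half-edges at the three crossings are read. *)
Definition triangle_fill x y z u1 u2 u3 u4 u5 u6 (h : hedge L) : S :=
  if h is inl (c, j) then
    if c == c1 then quad a x y u1 u2 j
    else if c == c2 then quad b y z u3 u4 j else quad d z x u5 u6 j
  else x.

Hypothesis un : uniq [:: c1; c2; c3].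

Lemma triangle_neq : [/\ c1 != c2, c1 != c3 & c2 != c3].
Proof. by move: un; rewrite /= !inE negb_or andbT => /andP[/andP[-> ->] ->]. Qed.

Lemma triangle_local th x y z :
  tri_rel (fv_virt L c1) (fv_virt L c2) (fv_virt L c3)
    (fv_inc L (inl (c1, a))) (fv_inc L (inl (c2, b))) (fv_inc L (inl (c3, d)))
    x y z (th q1) (th q2) (th q3) (th q4) (th q5) (th q6) ->
  (forall h, ~~ kept [set c1; c2; c3] set0 h ->
     th h = triangle_fill x y z (th q1) (th q2) (th q3) (th q4) (th q5) (th q6) h) ->
  local_coloring [set c1; c2; c3] set0 th.
Proof.
move=> R K; have [n12 n13 n23] := triangle_neq.
have [I1 I2 I3] := triangle_inc_sh3; have [F1 F2 F3] := triangle_lnk.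
have U1 j : th (inl (c1, j)) = quad a x y (th q1) (th q2) j.
  by rewrite K /= ?inE ?eqxx.
have U2 j : th (inl (c2, j)) = quad b y z (th q3) (th q4) j.
  by rewrite K /= ?inE ?eqxx ?orbT // eq_sym (negPf n12).
have U3 j : th (inl (c3, j)) = quad d z x (th q5) (th q6) j.
  by rewrite K /= ?inE ?eqxx ?orbT // !(eq_sym c3) (negPf n13) (negPf n23).
have [T1 [T2 [T3 [T4 [T5 [T6 [T7 [T8 T9]]]]]]]] := tri.
case: R => R1 R2 R3 R4 [R5 R6].
pose P c j := th (fv_lnk L (inl (c, j))) = th (inl (c, j)).
split=> [h /triangle_unkept[j []->]|e|c]; last first.
- rewrite !inE => /orP[/orP[]|] /eqP->.
  + by apply/(crossing_ruleP wf th c1 a); rewrite !U1 !quadE I1.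
  + by apply/(crossing_ruleP wf th c2 b); rewrite !U2 !quadE I2.
  by apply/(crossing_ruleP wf th c3 d); rewrite !U3 !quadE I3.
- by rewrite inE.
- by apply: (forall_sh (a := d) (P := P c3)); rewrite /P ?T3 ?F2 ?T8 ?T9 ?U1 ?U2 ?U3 !quadE.
- by apply: (forall_sh (a := b) (P := P c2)); rewrite /P ?T2 ?F1 ?T6 ?T7 ?U1 ?U2 ?U3 !quadE.
by apply: (forall_sh (a := a) (P := P c1)); rewrite /P ?T1 ?F3 ?T4 ?T5 ?U1 ?U2 ?U3 !quadE.
Qed.

Lemma triangle_weight th : is_coloring star circ th ->
  \sum_(c in [set c1; c2; c3]) crossing_weight th c =
  omv (fv_virt L c1) (fv_inc L (inl (c1, a))) (fv_inc L (inl (c2, b)))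
    (th (inl (c1, a))) (th (inl (c1, sh 1 a)))
  + omv (fv_virt L c2) (fv_inc L (inl (c2, b))) (fv_inc L (inl (c3, d)))
    (th (inl (c1, sh 1 a))) (th (inl (c2, sh 1 b)))
  + omv (fv_virt L c3) (fv_inc L (inl (c3, d))) (fv_inc L (inl (c1, a)))
    (th (inl (c2, sh 1 b))) (th (inl (c1, a))).
Proof.
move=> /is_coloringP[H1 _ H3]; have [n12 n13 n23] := triangle_neq.
have [I1 I2 I3] := triangle_inc_sh3; have [F1 F2 F3] := triangle_lnk.
rewrite -setUA !big_setU1 ?inE ?negb_or ?n12 //= big_set1 addrA.
rewrite (crossing_weightE wf a (H3 c1)) (crossing_weightE wf b (H3 c2)).
rewrite (crossing_weightE wf d (H3 c3)) I1 I2 I3.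
by rewrite -[th (inl (c2, b))]H1 -[th (inl (c3, d))]H1 -[th (inl (c3, sh 1 d))]H1 F1 F2;
   case: tri => _ [_ [-> _]].
Qed.
End Triangle.

(** * Invariance under each of the moves *)

Section Moves.
Variables (L L' : fv_diagram).
Hypotheses (wf : fv_wf L) (wf' : fv_wf L').

Lemma kept0 (K : fv_diagram) (h : hedge K) : kept set0 set0 h.
Proof. by case: h => [[]|[]] * /=; rewrite inE. Qed.

Lemma local_coloring0 (K : fv_diagram) (t : {ffun hedge K -> S}) :
  local_coloring set0 set0 t.
Proof. by split=> [h|b|c]; rewrite ?kept0 ?inE. Qed.

Lemma state_sum_bead_move : bead_move L L' ->
  state_sum star circ phi L = state_sum star circ phi L'.
Proof.
move=> [f [g [b [h1 [h2 [fr [e12 [E1 E2]]]]]]]].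
have F1 : fv_lnk L' (inr (b, false)) = hmap f g h1 by rewrite -E1 lnkK.
have F2 : fv_lnk L' (hmap f g h2) = inr (b, true) by rewrite -E2 lnkK.
have e21 : fv_lnk L h2 = h1 by rewrite -e12 lnkK.
have nk (h : hedge L') : ~~ kept set0 [set b] h -> exists s : bool, h = inr (b, s).
  by case: h => [[c i]|[b' s]] /=; rewrite !inE // negbK => /eqP->; exists s.
apply: (state_sum_frame wf' fr).
- by move=> h _; rewrite kept0.
- by move=> h; rewrite !inE => /orP[] /eqP-> _; rewrite ?E1 ?F2 /= inE eqxx.
- move=> th /is_coloringP[H1 _ _]; exists (fun _ => th h1) => u ag K.
  have Ub s : u (inr (b, s)) = th h1 by rewrite K //= inE eqxx.
  split=> [h /nk[s ->]|b'|c]; last by rewrite inE.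
    by rewrite Ub; case: s; rewrite ?E2 ?F1 ag ?kept0 // -e12 H1.
  by rewrite inE => /eqP->; rewrite !Ub.
- move=> u /is_coloringP[H1 H2 _]; exists (fun h => u (hmap f g h)) => th ag _.
  split; first exact: local_coloring0.
  have E : th h1 = th h2.
    by rewrite -!ag ?kept0 // -[u (hmap f g h1)]H1 E1 -H2 -E2 H1.
  by move=> h; rewrite !inE => /orP[] /eqP->; rewrite ?e12 ?e21.
- by move=> *; rewrite !big_set0.
- move=> u1 u2 /is_coloringP[C1 _ _] /is_coloringP[C2 _ _] K h.
  have [/K //|/nk[s ->]] := boolP (kept set0 [set b] h).
  by rewrite -C1 -C2; apply: K; case: s; rewrite ?E2 ?F1;
    apply: (hmap_kept fr); rewrite kept0.
- by move=> th1 th2 _ _ K h; apply: K; rewrite kept0.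
Qed.

Lemma state_sum_omega1 : omega1 L L' ->
  state_sum star circ phi L = state_sum star circ phi L'.
Proof.
move=> [f [g [c [i [h1 [h2 [fr [e12 [E0 [E2 E3]]]]]]]]]].
have F1 : fv_lnk L' (inl (c, sh 1 i)) = inl (c, i) by rewrite -E0 lnkK.
have F2 : fv_lnk L' (inl (c, sh 2 i)) = hmap f g h1 by rewrite -E2 lnkK.
have F3 : fv_lnk L' (inl (c, sh 3 i)) = hmap f g h2 by rewrite -E3 lnkK.
have e21 : fv_lnk L h2 = h1 by rewrite -e12 lnkK.
have I1 : fv_inc L' (inl (c, sh 1 i)) = ~~ fv_inc L' (inl (c, i)).
  by rewrite -inc_lnk // E0.
have nk (h : hedge L') : ~~ kept [set c] set0 h -> exists j, h = inl (c, j).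
  by case: h => [[c' j]|[b s]] /=; rewrite !inE // negbK => /eqP->; exists j.
apply: (state_sum_frame wf' fr).
- by move=> h _; rewrite kept0.
- by move=> h; rewrite !inE => /orP[] /eqP-> _; rewrite ?E2 ?E3 /= inE eqxx.
- move=> th /is_coloringP[H1 _ _]; set y := th h1.
  (* The loop colour comes from [y] by the inverse of the operator of [y], and [x] has the same
     operator class as [y]. *)
  pose x := act (fv_virt L' c) (fv_inc L' (inl (c, sh 1 i))) y y.
  exists (fun h => if h is inl (_, j) then quad i x x y y j else y) => u ag K.
  have Uc j : u (inl (c, j)) = quad i x x y y j by rewrite K //= inE eqxx.
  split=> [h /nk[j ->]|b|c']; [ |by rewrite inE|rewrite inE => /eqP->].
    have th2 : th h2 = y by rewrite -e12 H1.
    apply: (forall_sh (a := i) (P := fun j => u (fv_lnk L' (inl (c, j))) = u (inl (c, j))));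
      rewrite ?E0 ?F1 ?F2 ?F3 ?ag ?kept0 // !Uc !quadE //.
  apply/(crossing_ruleP wf' u c i); rewrite !Uc !quadE inc_sh3 // I1.
  by rewrite /x I1 !act_act ?negbK actNK.
- move=> u /is_coloringP[H1 _ H3]; exists (fun h => u (hmap f g h)) => th ag _.
  split; first exact: local_coloring0.
  have E : th h1 = th h2.
    have [R0 R1] := crossing_rule_inv wf' i (H3 c).
    rewrite -!ag ?kept0 // -(H1 (hmap f g h1)) -(H1 (hmap f g h2)) E2 E3.
    move: R1; rewrite -[u (inl (c, sh 1 i))]H1 F1 R0 I1.
    exact: act_swap.
  by move=> h; rewrite !inE => /orP[] /eqP->; rewrite ?e12 ?e21.
- move=> th u _ _ /is_coloringP[H1 _ H3]; rewrite big_set0 big_set1.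
  (* The loop gives the two inner ports one colour and the two strands equal flags, which is the
     diagonal case. *)
  rewrite (crossing_weightE wf' i (H3 c)) inc_sh3 // I1 negbK.
  by rewrite -[u (inl (c, sh 1 i))]H1 F1 /omv om_diag; case: fv_virt.
- move=> u1 u2 /is_coloringP[C1 _ D1] /is_coloringP[C2 _ D2] K h.
  have [/K //|/nk[j ->]] := boolP (kept [set c] set0 h).
  have X2 : u1 (inl (c, sh 2 i)) = u2 (inl (c, sh 2 i)).
    by rewrite -C1 -C2 F2; apply: K; apply: (hmap_kept fr); rewrite kept0.
  have X3 : u1 (inl (c, sh 3 i)) = u2 (inl (c, sh 3 i)).
    by rewrite -C1 -C2 F3; apply: K; apply: (hmap_kept fr); rewrite kept0.
  exact: (crossing_rule_ext wf' _ (D1 c) (D2 c) X2 X3).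
- by move=> th1 th2 _ _ K h; apply: K; rewrite kept0.
Qed.

Lemma state_sum_omega2 : omega2 L L' ->
  state_sum star circ phi L = state_sum star circ phi L'.
Proof.
move=> [f [g [c1 [c2 [i [j [h1 [h1' [h2 [h2' [ne [fr [e1 [e2 [_ [_ [ev H]]]]]]]]]]]]]]]]].
(* Base port of c2 making it the mirror image of c1. *)
have [k Ek] : exists k, j = sh 1 k by exists (sh 3 j); rewrite shE.
move: H; rewrite {}Ek !shE => {j} -[E0 [E1 [E2 [E3 [E4 E5]]]]].
have e1' : fv_lnk L h1' = h1 by rewrite -e1 lnkK.
have e2' : fv_lnk L h2' = h2 by rewrite -e2 lnkK.
have F0 : fv_lnk L' (inl (c2, sh 1 k)) = inl (c1, i) by rewrite -E0 lnkK.
have F1 : fv_lnk L' (inl (c2, k)) = inl (c1, sh 1 i) by rewrite -E1 lnkK.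
have F2 : fv_lnk L' (inl (c1, sh 2 i)) = hmap f g h1 by rewrite -E2 lnkK.
have F3 : fv_lnk L' (inl (c2, sh 3 k)) = hmap f g h1' by rewrite -E3 lnkK.
have F4 : fv_lnk L' (inl (c1, sh 3 i)) = hmap f g h2 by rewrite -E4 lnkK.
have F5 : fv_lnk L' (inl (c2, sh 2 k)) = hmap f g h2' by rewrite -E5 lnkK.
have I0 : fv_inc L' (inl (c2, sh 1 k)) = ~~ fv_inc L' (inl (c1, i)).
  by rewrite -inc_lnk // E0.
have I1 : fv_inc L' (inl (c2, k)) = ~~ fv_inc L' (inl (c1, sh 1 i)).
  by rewrite -inc_lnk // E1.
have nk (h : hedge L') : ~~ kept [set c1; c2] set0 h ->
    exists m, h = inl (c1, m) \/ h = inl (c2, m).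
  case: h => [[c m]|[b s]] /=; rewrite !inE // negbK => /orP[] /eqP->; exists m;
  by [left | right].
apply: (state_sum_frame wf' fr).
- by move=> h _; rewrite kept0.
- by move=> h; rewrite !inE => /orP[/orP[/orP[]|]|] /eqP-> _;
    rewrite ?E2 ?E3 ?E4 ?E5 /= !inE eqxx ?orbT.
- move=> th /is_coloringP[H1 _ _]; set p := th h1; set q := th h2.
  (* The sides of the bigon get the colours that [crossing_rule_inv] forces at [c1]. *)
  pose x0 := act (fv_virt L' c1) (fv_inc L' (inl (c1, sh 1 i))) p q.
  pose x1 := act (fv_virt L' c1) (~~ fv_inc L' (inl (c1, i))) q p.
  exists (fun h => if h is inl (c, j) then
      if c == c1 then quad i x0 x1 p q j else quad k x1 x0 q p j else p) => u ag K.
  have U1 j : u (inl (c1, j)) = quad i x0 x1 p q j.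
    by rewrite K /= ?inE ?eqxx.
  have U2 j : u (inl (c2, j)) = quad k x1 x0 q p j.
    by rewrite K /= ?inE ?eqxx ?orbT // eq_sym (negPf ne).
  have t1 : th h1' = p by rewrite -e1 H1.
  have t2 : th h2' = q by rewrite -e2 H1.
  split=> [h /nk[m []->]|b|c]; [| |by rewrite inE|rewrite !inE => /orP[]/eqP->].
  + by apply: (forall_sh (a := i) (P := fun j => u (fv_lnk L' (inl (c1, j))) = u (inl (c1, j))));
      rewrite ?E0 ?E1 ?F2 ?F4 ?ag ?kept0 // ?U1 ?U2 !quadE.
  + by apply: (forall_sh (a := k) (P := fun j => u (fv_lnk L' (inl (c2, j))) = u (inl (c2, j))));
      rewrite ?F0 ?F1 ?F3 ?F5 ?ag ?kept0 // ?U1 ?U2 !quadE.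
  + apply/(crossing_ruleP wf' u c1 i); rewrite !U1 !quadE inc_sh3 //.
    by rewrite /x0 /x1 !act_act actK actNK.
  apply/(crossing_ruleP wf' u c2 k); rewrite !U2 !quadE inc_sh3 // I0 I1 negbK -ev.
  by rewrite /x0 /x1 !act_act actK actNK.
- move=> u /is_coloringP[H1 _ H3]; exists (fun h => u (hmap f g h)) => th ag _.
  split; first exact: local_coloring0.
  have [P2 P3] := proj1 (crossing_ruleP wf' u c1 i) (H3 c1).
  have [Q2 Q3] := proj1 (crossing_ruleP wf' u c2 k) (H3 c2).
  (* In terms of the data at [c1], the rule at [c2] is the rule at [c1] with the strands exchanged,
     so the two outer ends of each strand have equal colours. *)
  move: Q2 Q3; rewrite !inc_sh3 // I0 I1 negbK -ev -inc_sh3 // => Q2 Q3.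
  move: Q2 Q3; rewrite -[u (inl (c2, k))]H1 -[u (inl (c2, sh 1 k))]H1 F0 F1.
  rewrite -P2 -P3 -[u (inl (c2, sh 3 k))]H1 -[u (inl (c2, sh 2 k))]H1 F3 F5.
  rewrite -[u (inl (c1, sh 2 i))]H1 -[u (inl (c1, sh 3 i))]H1 F2 F4 !ag ?kept0 // => Q2 Q3.
  by move=> h; rewrite !inE => /orP[/orP[/orP[]|]|] /eqP->;
    rewrite ?e1 ?e2 ?e1' ?e2' ?Q2 ?Q3.
- move=> th u _ _ /is_coloringP[H1 _ H3]; rewrite big_set0 big_setU1 ?inE //= big_set1.
  rewrite (crossing_weightE wf' i (H3 c1)) (crossing_weightE wf' k (H3 c2)).
  rewrite -[u (inl (c2, k))]H1 -[u (inl (c2, sh 1 k))]H1 F0 F1 -ev.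
  rewrite !inc_sh3 // I0 I1 negbK /omv; case: fv_virt; rewrite ?addr0 //.
  by rewrite [X in _ + X]om_swap subrr.
- move=> u1 u2 /is_coloringP[C1 _ D1] /is_coloringP[C2 _ D2] K.
  have X h : u1 (hmap f g h) = u2 (hmap f g h).
    by apply: K; apply: (hmap_kept fr); rewrite kept0.
  have X2 : u1 (inl (c1, sh 2 i)) = u2 (inl (c1, sh 2 i)) by rewrite -C1 -C2 F2.
  have X3 : u1 (inl (c1, sh 3 i)) = u2 (inl (c1, sh 3 i)) by rewrite -C1 -C2 F4.
  have X4 : u1 (inl (c2, sh 2 k)) = u2 (inl (c2, sh 2 k)) by rewrite -C1 -C2 F5.
  have X5 : u1 (inl (c2, sh 3 k)) = u2 (inl (c2, sh 3 k)) by rewrite -C1 -C2 F3.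
  move=> h; have [/K //|/nk[m]] := boolP (kept [set c1; c2] set0 h).
  case=> ->; first exact: (crossing_rule_ext wf' _ (D1 c1) (D2 c1) X2 X3).
  exact: (crossing_rule_ext wf' _ (D1 c2) (D2 c2) X4 X5).
- by move=> th1 th2 _ _ K h; apply: K; rewrite kept0.
Qed.

Lemma state_sum_omega3 : omega3 L L' ->
  state_sum star circ phi L = state_sum star circ phi L'.
Proof.
move=> [f [g [c1 [c2 [c3 [a [b [d [c1' [c2' [c3' [a' [b' [d' H]]]]]]]]]]]]]].
move: H => [p1 [p2 [p3 [p4 [p5 [p6 [un [un' [fr [kp [T [T' [w1 [w2 [w3 nv]]]]]]]]]]]]]]].
have [k1 [k2 [k3 [k4 [k5 k6]]]]] : kept [set c1; c2; c3] set0 p1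
    /\ kept [set c1; c2; c3] set0 p2 /\ kept [set c1; c2; c3] set0 p3
    /\ kept [set c1; c2; c3] set0 p4 /\ kept [set c1; c2; c3] set0 p5
    /\ kept [set c1; c2; c3] set0 p6.
  by move: kp; rewrite /= andbT => /and5P[-> -> -> -> /andP[-> ->]].
have [i1 i2 i3 [i4 i5 i6]] := triangle_inc wf T.
have [j1 j2 j3 [j4 j5 j6]] := triangle_inc wf' T'.
have incf h : kept [set c1; c2; c3] set0 h -> fv_inc L' (hmap f g h) = fv_inc L h.
  by case: fr => _ [_ [_ [_ [_ [_ incf]]]]]; apply: incf.
(* Outer ends keep their orientation, but the half-turn lets them leave from the other side of the
   triangle, which negates all three flags. *)
have n1 : fv_inc L' (inl (c1', a')) = ~~ fv_inc L (inl (c1, a)) by rewrite -j1 incf.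
have n2 : fv_inc L' (inl (c2', b')) = ~~ fv_inc L (inl (c2, b)) by rewrite -j3 incf.
have n3 : fv_inc L' (inl (c3', d')) = ~~ fv_inc L (inl (c3, d)) by rewrite -j5 incf.
apply: (state_sum_frame wf' fr).
- move=> h k nk; have := triangle_outer wf T nk; rewrite lnkK //; exact.
- move=> h hb k; apply: (triangle_boundary wf' T'); move: hb.
  by rewrite !inE => /orP[/orP[/orP[/orP[/orP[]|]|]|]|] /eqP->; rewrite eqxx ?orbT.
- move=> th /(triangle_coloring wf T) /tri_rel_flip; rewrite -n1 -n2 -n3 -w1 -w2 -w3.
  set x := act _ _ (act _ _ _ _) _; set y := act _ _ (act _ _ _ _) _.
  set z := act _ _ (act _ _ _ _) _ => R.
  exists (triangle_fill c1' c2' a' b' d' x y z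
            (th p6) (th p3) (th p2) (th p5) (th p4) (th p1)) => u ag K.
  by apply: (triangle_local wf' T' un' (x := x) (y := y) (z := z)); rewrite !ag.
- move=> u /(triangle_coloring wf' T') /tri_rel_flip; rewrite n1 n2 n3 w1 w2 w3 !negbK.
  set x := act _ _ (act _ _ _ _) _; set y := act _ _ (act _ _ _ _) _.
  set z := act _ _ (act _ _ _ _) _ => R.
  exists (triangle_fill c1 c2 a b d x y z
            (u (hmap f g p1)) (u (hmap f g p2)) (u (hmap f g p3))
            (u (hmap f g p4)) (u (hmap f g p5)) (u (hmap f g p6))) => th ag K.
  have loc : local_coloring [set c1; c2; c3] set0 th.
    by apply: (triangle_local wf T un (x := x) (y := y) (z := z)); rewrite -!ag.
  split=> // h hb; case: loc => loc _ _.
  by rewrite -(loc _ (triangle_boundary wf T hb)) lnkK.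
- move=> th u ag C C'; rewrite (triangle_weight wf T un C) (triangle_weight wf' T' un' C').
  have [_ Q2 Q3 Q4 [Q5 Q6]] := triangle_coloring wf T C.
  have := triangle_coloring wf' T' C'; rewrite n1 n2 n3 w1 w2 w3 !ag //.
  (* Read from opposite ports, the new weights involve only outer colours, which are then expressed
     by the old inner ones. Old minus new is exactly [drift_sum]. *)
  rewrite !omv_neg2 => -[<- <- <- <- [<- <-]]; rewrite Q2 Q3 Q4 Q5 Q6.
  have [Q1 _ _ _ _] := triangle_coloring wf T C; rewrite Q1.
  apply/esym/eqP; rewrite -subr_eq0; apply/eqP.
  have := drift_sum0 (v1 := fv_virt L c1) (v2 := fv_virt L c2) (v3 := fv_virt L c3).
  move=> /(_ (fv_inc L (inl (c1, a))) (fv_inc L (inl (c2, b))) (fv_inc L (inl (c3, d)))).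
  move=> /(_ (th (inl (c1, a))) (th (inl (c1, sh 1 a))) (th (inl (c2, sh 1 b))) nv) <-.
  by rewrite /drift_sum /drift !opprD !addrA [LHS](AC 6 (1*4*2*5*3*6)).
- move=> u1 u2 C1 C2 K h; have [/K //|nk] := boolP (kept [set c1'; c2'; c3'] set0 h).
  by apply: (triangle_ext wf' T') nk; rewrite // K // (hmap_kept fr).
- move=> t1 t2 C1 C2 K h; have [/K //|nk] := boolP (kept [set c1; c2; c3] set0 h).
  by apply: (triangle_ext wf T) nk; rewrite // K.
Qed.
End Moves.

Lemma state_sum_flat_move L L' : fv_wf L -> fv_wf L' -> flat_move L L' ->
  state_sum star circ phi L = state_sum star circ phi L'.
Proof.
move=> wf wf' [|[|[]]].
- exact: state_sum_bead_move.
- exact: state_sum_omega1.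
- exact: state_sum_omega2.
exact: state_sum_omega3.
Qed.
End Biquandle.

Theorem theorem5p4 (S : finType) (star circ : S -> S -> S) (A : zmodType)
    (phi : S -> S -> A) :
  vf_biquandle star circ ->
  (forall a : A, a + a = 0 -> a = 0) ->
  cocycle_conditions star circ phi ->
  forall L L' : fv_diagram, fv_equiv L L' ->
    state_sum star circ phi L = state_sum star circ phi L'.
Proof.
move=> biq tors coc L L'; elim=> {L L'} [L L'|//|L L' _ -> //|L1 L2 L3 _ -> _ -> //].
by move=> [wf [_ [wf' [_ mv]]]]; apply: state_sum_flat_move mv.
Qed.
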